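(* Let $n\ge 3$ and let $\mathcal{F}=\{\Omega_{i_1j_1},\dots,\Omega_{i_mj_m}\}\subseteq\mathcal{B}$ with $1\le i_k<j_k\le n$ for $k=1,\dots,m$. The control system on $\mathrm{SO}(n)$ $$\dot X(t)=\Big[\sum_{k=1}^m u_k(t)\,\Omega_{i_kj_k}\Big]X(t),\qquad X(0)=I,$$ is controllable if and only if $\tilde\iota(\mathcal{F})=[(1,\dots,n)]$ in $(S_n/\!\sim,* )$.
   Context: $E_{ij}\in\mathbb{R}^{n\times n}$ is the matrix whose $(i,j)$ entry is $1$ and whose other entries are $0$; $\Omega_{ij}=E_{ij}-E_{ji}$; $\mathcal{B}=\{\Omega_{ij}:1\le i<j\le n\}$ is the standard basis of $\mathfrak{so}(n)$. The controls $u_k(t)\in\mathbb{R}$ are piecewise constant. The system is controllable if every element of $\mathrm{SO}(n)$ can be reached from $X(0)=I$ in finite time by some choice of controls. $S_n$ is the symmetric group on $\{1,\dots,n\}$ with operation ''$\cdot$''. For $\sigma,\eta\in S_n$, $\sigma\sim\eta$ iff they have the same orbits on $\{1,\dots,n\}$; $[\sigma]$ is the class of $\sigma$. For transpositions, $\sigma*\eta=\sigma$ if $\sigma=\eta$ and $\sigma*\eta=\sigma\cdot\eta$ otherwise. More generally, for $\sigma\in S_n$ and a transposition $\tau=(i,j)$, $\sigma*\tau=\sigma$ if $i,j$ lie in the same orbit of $\sigma$, and $\sigma*\tau=\sigma\cdot\tau$ otherwise; a product $\sigma*\eta$ is obtained by writing $\eta$ as a product of a minimal number of transpositions and applying this rule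 successively. This induces a commutative, associative operation $[\sigma]*[\eta]=[\sigma*\eta]$ on $S_n/\!\sim$. The map $\tilde\iota:\mathcal{P}(\mathcal{B})\to S_n/\!\sim$ is given by $\{\Omega_{a_1b_1},\dots,\Omega_{a_lb_l}\}\mapsto[(a_1,b_1)*\cdots*(a_l,b_l)]$, where $(a,b)$ is the transposition exchanging $a$ and $b$, with $\tilde\iota(\varnothing)=[e]$, $e$ the identity. $(1,\dots,n)$ is the $n$-cycle. *)

(* Defs.v *)
From mathcomp Require Import all_boot all_order all_algebra all_fingroup.
From mathcomp Require Import finmap zify.
From mathcomp Require Import all_classical all_reals all_analysis.

Set Implicit Arguments.
Unset Strict Implicit.
Unset Printing Implicit Defensive.

Import Order.TTheory GRing.Theory Num.Theory.
Import numFieldNormedType.Exports.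
Local Open Scope classical_set_scope.
Local Open Scope ring_scope.

Definition Omega (R : realType) (n : nat) (i j : 'I_n) : 'M[R]_n :=
  delta_mx i j - delta_mx j i.

Definition SO (R : realType) (n : nat) (X : 'M[R]_n) : Prop :=
  X *m X^T = 1%:M /\ \det X = 1.

(* Constancy is required on the open pieces only: the values at the finitely
   many switching times are irrelevant. *)
Definition piecewise_constant (R : realType) (T : R) (u : R -> R) : Prop :=
  exists2 s : seq R, itv_partition 0 T s &
    forall k, (k < size s)%N ->
      {in `]nth 0 (0 :: s) k, nth 0 (0 :: s) k.+1[ &, forall x y, u x = u y}.

(* Solutions are continuous on [0, T] and satisfy the equation except at
   finitely many times, such as the switching times of u. *)
Definition trajectory (R : realType) (n m : nat) (A : 'I_m -> 'M[R]_n)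
    (T : R) (u : 'I_m -> R -> R) (X : R -> 'M[R]_n) : Prop :=
  [/\ X 0 = 1%:M,
      {within `[0, T], continuous X} &
      exists D : seq R, forall t, t \in `]0, T[ -> t \notin D ->
        is_derive t 1 X ((\sum_(k < m) u k t *: A k) *m X t)].

Definition controllable (R : realType) (n m : nat) (A : 'I_m -> 'M[R]_n) : Prop :=
  forall Y : 'M[R]_n, SO Y ->
    exists T : R, exists u : 'I_m -> R -> R, exists X : R -> 'M[R]_n,
      [/\ 0 <= T, forall k, piecewise_constant T (u k),
          trajectory A T u X & X T = Y].

Definition same_orbits (n : nat) : rel 'S_n :=
  fun s t => porbits s == porbits t.

Lemma same_orbits_refl n : reflexive (@same_orbits n).
Proof. by move=> s; exact: eqxx. Qed.

Lemma same_orbits_sym n : symmetric (@same_orbits n).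
Proof. by move=> s t; exact: eq_sym. Qed.

Lemma same_orbits_trans n : transitive (@same_orbits n).
Proof. by move=> t s r /eqP st /eqP tr; rewrite /same_orbits st tr. Qed.

Canonical same_orbits_equiv (n : nat) :=
  EquivRel (@same_orbits n) (@same_orbits_refl n) (@same_orbits_sym n)
    (@same_orbits_trans n).

Local Open Scope quotient_scope.

Definition perm_orb (n : nat) := {eq_quot @same_orbits n}.

Definition orb_class (n : nat) (s : 'S_n) : perm_orb n := \pi_(perm_orb n) s.

(* tperm p.1 p.2 is on the left because products in {perm T} compose from left
   to right, so that it is applied before s; s * tperm p.1 p.2 has the same
   orbits when p.1 and p.2 lie in different orbits of s. *)
Definition star_tperm (n : nat) (s : 'S_n) (p : 'I_n * 'I_n) : 'S_n :=
  if p.1 \in porbit s p.2 then s else (tperm p.1 p.2 * s)%g.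

(* (a_1, b_1) * ... * (a_l, b_l), bracketed to the left *)
Definition star_tperms (n : nat) (l : seq ('I_n * 'I_n)) : 'S_n :=
  foldl (@star_tperm n) 1%g l.

(* The factors are taken in the order of the enumeration of 'I_n * 'I_n;
   iota_classE shows that any other listing of F gives the same class. *)
Definition iota_class (R : realType) (n : nat) (F : {fset 'M[R]_n}) : perm_orb n :=
  orb_class (star_tperms
    [seq p : 'I_n * 'I_n <- enum predT | (p.1 < p.2)%N && (Omega R p.1 p.2 \in F)]).

Definition full_cycle (n : nat) : 'S_n := perm (@ordS_inj n).

Lemma Omega_inj (R : realType) (n : nat) (a b c d : 'I_n) :
  (a < b)%N -> (c < d)%N -> Omega R a b = Omega R c d -> (a, b) = (c, d).
Proof.
move=> ab cd /matrixP /(_ a b); rewrite !mxE !eqxx /=.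
have -> : (a == b) = false by apply/negbTE; rewrite neq_ltn ab.
rewrite /= subr0.
case: (eqVneq a c) => [ac|_]; case: (eqVneq b d) => [bd|_] /=.
- by rewrite ac bd.
all: case: (andP (b1 := a == d) (b2 := b == c)) => [[/eqP ad /eqP bc]|_].
1,3,5: by rewrite ad bc ltnNge ltnW in ab.
all: by move=> /eqP; rewrite subr0 oner_eq0.
Qed.

Lemma porbit_step (n : nat) (s : 'S_n) (r : rel 'I_n) :
  reflexive r -> transitive r -> (forall z, r z (s z)) ->
  forall z w, w \in porbit s z -> r z w.
Proof.
move=> rr rt rs z w /porbitP[k ->].
elim: k => [|k IH]; first by rewrite expg0 perm1.
by rewrite expgSr permM; apply: rt IH (rs _).
Qed.

Lemma porbit_trans (n : nat) (s : 'S_n) :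
  transitive (fun z w => w \in porbit s z).
Proof.
move=> y x z; rewrite -!eq_porbit_mem => /eqP -> /eqP ->.
exact: eqxx.
Qed.

Lemma star_tperm_porbit (n : nat) (s : 'S_n) (p : 'I_n * 'I_n) (z w : 'I_n) :
  (w \in porbit (star_tperm s p) z) =
  (w \in porbit s z) ||
    ((z \in porbit s p.1) || (z \in porbit s p.2)) &&
    ((w \in porbit s p.1) || (w \in porbit s p.2)).
Proof.
case: p => x y /=; rewrite /star_tperm /=.
case: ifPn => [xy|xy].
  have -> : (z \in porbit s x) = (z \in porbit s y).
    by rewrite -!eq_porbit_mem (eqP (_ : porbit s x == porbit s y)) ?eq_porbit_mem.
  have -> : (w \in porbit s x) = (w \in porbit s y).
    by rewrite -!eq_porbit_mem (eqP (_ : porbit s x == porbit s y)) ?eq_porbit_mem.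
  rewrite !orbb; case: (boolP (w \in _)) => //= nwz; apply/esym/negbTE.
  apply: contra nwz => /andP[zy wy].
  by apply: porbit_trans wy; rewrite porbit_sym.
have nxy : x != y by apply: contraNneq xy => ->; exact: porbit_id.
pose s' := (tperm x y * s)%g.
have ss' : s = (tperm x y * s')%g by rewrite /s' mulgA tperm2 mul1g.
have xy' : x \in porbit s' y.
  move: (porbits_mul_tperm s x y) (porbits_mul_tperm s' x y) => /=.
  rewrite -ss' -/s' xy nxy; case: (x \in _) => //=.
  by move: #|porbits s| #|porbits s'| => a b; clear; lia.
have yx' : y \in porbit s' x by rewrite porbit_sym.
have sub z1 w1 : w1 \in porbit s z1 -> w1 \in porbit s' z1.
  move: z1 w1; apply: (@porbit_step _ _ (fun z w => w \in porbit s' z)).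
  - by move=> ?; exact: porbit_id.
  - exact: porbit_trans.
  - move=> u; rewrite ss' permM; case: tpermP => [->|->|_ _].
    + apply: porbit_trans yx' _; exact: (mem_porbit s' 1).
    + apply: porbit_trans xy' _; exact: (mem_porbit s' 1).
    + exact: (mem_porbit s' 1).
pose r : rel 'I_n := fun z w => (w \in porbit s z) ||
    ((z \in porbit s x) || (z \in porbit s y)) &&
    ((w \in porbit s x) || (w \in porbit s y)).
have tr a b c : b \in porbit s a -> (a \in porbit s c) = (b \in porbit s c).
  by rewrite -!(porbit_sym s c) -!eq_porbit_mem => /eqP ->.
apply/idP/idP.
  move: z w; apply: (@porbit_step _ _ r).
  - by move=> u; rewrite /r porbit_id.
  - move=> v u t; rewrite /r => /orP[uv|/andP[hu hv]] /orP[vt|/andP[hv' ht]].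
    + by rewrite (porbit_trans uv vt).
    + by rewrite ht !(tr _ _ _ uv) hv' orbT.
    + by rewrite hu -!(tr _ _ _ vt) hv orbT.
    + by rewrite hu ht orbT.
  - move=> u; rewrite /r permM; case: tpermP => [->|->|_ _].
    + by rewrite porbit_id (mem_porbit s 1) !orbT.
    + by rewrite porbit_id (mem_porbit s 1) !orbT.
    + by rewrite (mem_porbit s 1).
case/orP => [|/andP[hz hw]]; first exact: sub.
have hx v : (v \in porbit s x) || (v \in porbit s y) -> v \in porbit s' x.
  by case/orP => [/sub//|/sub vy]; exact: porbit_trans yx' vy.
by apply: porbit_trans (hx _ hw); rewrite porbit_sym; exact: hx.
Qed.

Definition edges (n : nat) (l : seq ('I_n * 'I_n)) : rel 'I_n :=
  fun z w => ((z, w) \in l) || ((w, z) \in l).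

Lemma star_tperms_porbit (n : nat) (l : seq ('I_n * 'I_n)) (z w : 'I_n) :
  (w \in porbit (star_tperms l) z) = connect (edges l) z w.
Proof.
have esym k : connect_sym (@edges n k).
  by apply: sym_connect_sym => u v; rewrite /edges orbC.
elim/last_ind: l z w => [|l p IH] z w.
  rewrite /star_tperms /=; apply/idP/idP.
    move: z w; apply: porbit_step.
    - exact: connect0.
    - exact: connect_trans.
    - by move=> u; rewrite perm1 connect0.
  by case/connectP => [[|v q] //= _ ->]; exact: porbit_id.
rewrite /star_tperms foldl_rcons -/(star_tperms l) star_tperm_porbit !IH.
have mono u v : connect (edges l) u v -> connect (edges (rcons l p)) u v.
  apply: connect_sub => a b ab; apply: connect1.
  by rewrite /edges !mem_rcons !inE; case/orP: ab => ->; rewrite !orbT.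
have ep : connect (edges (rcons l p)) p.1 p.2.
  by apply: connect1; rewrite /edges mem_rcons inE -surjective_pairing eqxx.
apply/idP/idP.
  case/orP => [/mono//|/andP[hz hw]].
  have h v : connect (edges l) p.1 v || connect (edges l) p.2 v ->
      connect (edges (rcons l p)) p.1 v.
    by case/orP => /mono //; exact: connect_trans.
  by apply: connect_trans (h _ hw); rewrite esym; exact: h.
case/connectP => q; elim: q z => [|v q IHq] z /=.
  by move=> _ ->; rewrite connect0.
case/andP => zv hq ew; have := IHq _ hq ew.
have : (edges l z v) || ((z == p.1) && (v == p.2) || (z == p.2) && (v == p.1)).
  move: zv; rewrite /edges !mem_rcons !inE -!pair_eqE /= .
  by case: p {IH IHq hq mono ep} => a b /=; do !case: (_ == _); rewrite ?orbT ?orbF.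
have sm := esym l.
case/orP => [/connect1 zv1|].
  case/orP => [vw|/andP[hv ->]]; first by rewrite (connect_trans zv1 vw).
  rewrite sm in zv1; rewrite andbT; apply/orP; right.
  by case/orP: hv => /connect_trans /(_ zv1) ->; rewrite ?orbT.
case/orP => /andP[/eqP -> /eqP ->]; rewrite !connect0 ?orbT /=.
all: by case/orP => [->|->]; rewrite ?orbT.
Qed.

Lemma orb_class_eq (n : nat) (s t : 'S_n) :
  orb_class s = orb_class t <-> porbits s = porbits t.
Proof.
by split=> [/eqmodP/eqP//|st]; apply/eqmodP/eqP.
Qed.

Lemma orb_class_star_tperms (n : nat) (l1 l2 : seq ('I_n * 'I_n)) :
  l1 =i l2 -> orb_class (star_tperms l1) = orb_class (star_tperms l2).
Proof.
move=> l12; apply/orb_class_eq/eq_imset => z; apply/setP => w.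
rewrite !star_tperms_porbit; apply: eq_connect => a b.
by rewrite /edges !l12.
Qed.

Lemma iota_classE (R : realType) (n : nat) (l : seq ('I_n * 'I_n)) :
  all (fun p : 'I_n * 'I_n => p.1 < p.2)%N l ->
  iota_class [fset Omega R p.1 p.2 | p in l]%fset = orb_class (star_tperms l).
Proof.
move=> hl; apply: orb_class_star_tperms => p.
rewrite mem_filter mem_enum andbT; apply/andP/idP.
  case=> hp /imfsetP[/= q ql].
  move=> /(Omega_inj hp (allP hl _ ql)).
  by rewrite -!surjective_pairing => ->.
move=> pl; split; first exact: (allP hl).
by apply/imfsetP; exists p.
Qed.

(* Main.v *)
Require Import Defs.
From mathcomp Require Import all_boot all_order all_algebra all_fingroup.
From mathcomp Require Import finmap zify ring lra.
From mathcomp Require Import all_classical all_reals all_analysis.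

(** Let G be the graph on the indices 0, .., n - 1 whose edges are the pairs
    (i k, j k).  The orbits of the product of the transpositions (i k, j k)
    under * are the connected components of G, so the condition on
    [iota_class] says that G is connected ([iota_class_full_cycle]).

    If G is not connected, let C be the component of an index z and let w lie
    outside C.  In column w of a trajectory, the entries with row in C evolve
    among themselves under a skew-symmetric system, because no edge leaves C.
    The sum of their squares is therefore constant; it is 0 at time 0, so it
    remains 0 ([trajectory_entry0]).  The quarter turn in the plane (z, w) has a
    nonzero entry there and is never reached ([controllable_connected]).

    If G is connected, a constant control on the k-th input for a time 1
    multiplies the current state by an arbitrary rotation exp (t A_k)
    ([reached_step]).  A quarter turn in the plane (c, b) conjugates the
    rotations of the plane (a, b) into those of the plane (a, c)
    ([rotm_Omega_conj]), so along the paths of G the rotations of every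
    coordinate plane become available ([steerable_plane_trans]).  They generate
    SO(n) by Givens elimination ([SO_Givens_ind]).  *)

Set Implicit Arguments.
Unset Strict Implicit.
Unset Printing Implicit Defensive.

Import Order.TTheory GRing.Theory Num.Theory.
Import numFieldNormedType.Exports.
Local Open Scope classical_set_scope.
Local Open Scope ring_scope.

(** * Rotations in a coordinate plane *)

Section Rotations.
Variables (R : realType) (n : nat).
Implicit Types (W Y : 'M[R]_n) (t : R).

(** Rodrigues' formula: this is exp (t W) when W ^ 3 = - W, the only relation
    that the exponential law [rotmD] requires. *)
Definition rotm W t : 'M[R]_n :=
  1%:M + sin t *: W + (1 - cos t) *: (W *m W).

Lemma rotm0 W : rotm W 0 = 1%:M.
Proof. by rewrite /rotm sin0 cos0 subrr !scale0r !addr0. Qed.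

Lemma rotmN W t : rotm (- W) t = rotm W (- t).
Proof. by rewrite /rotm mulNmx mulmxN opprK sinN cosN scalerN scaleNr. Qed.

Lemma rotmD W s t : W *m W *m W = - W -> rotm W s *m rotm W t = rotm W (s + t).
Proof.
move=> W3; rewrite /rotm sinD cosD; set V := W *m W in W3 *.
have WV : W *m V = - W by rewrite /V mulmxA.
have VV : V *m V = - V by rewrite {2}/V mulmxA W3 mulNmx.
rewrite !mulmxDl !mulmxDr !mul1mx -!scalemxAl -!scalemxAr !mulmx1 WV W3 VV -/V.
by apply/matrixP => x y; rewrite !mxE; ring.
Qed.

Lemma rotmK W t : W *m W *m W = - W -> rotm W (- t) *m rotm W t = 1%:M.
Proof. by move=> W3; rewrite rotmD// addNr rotm0. Qed.

Lemma tr_rotm W t : W^T = - W -> (rotm W t)^T = rotm W (- t).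
Proof.
move=> Wt; rewrite /rotm !linearD /= !linearZ /= trmx1 trmx_mul Wt.
by rewrite mulNmx mulmxN opprK sinN cosN scalerN scaleNr.
Qed.

(** The rotation by t is the square of the rotation by t / 2, so its determinant
    is the square of a determinant equal to 1 or -1. *)
Lemma rotm_SO W t : W *m W *m W = - W -> W^T = - W -> SO (rotm W t).
Proof.
move=> W3 Wt; have orth s : rotm W s *m (rotm W s)^T = 1%:M.
  by rewrite tr_rotm// rotmD// subrr rotm0.
split=> //; rewrite [t]splitr -rotmD// det_mulmx.
by rewrite -{2}(det_tr (rotm W (t / 2))) -det_mulmx orth det1.
Qed.

Lemma mul_rotm W t p (Y : 'M[R]_(n, p)) :
  rotm W t *m Y = Y + sin t *: (W *m Y) + (1 - cos t) *: (W *m (W *m Y)).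
Proof. by rewrite /rotm !mulmxDl mul1mx -!scalemxAl mulmxA. Qed.

Lemma SO_mul Y Z : SO Y -> SO Z -> SO (Y *m Z).
Proof.
move=> [Y1 Y2] [Z1 Z2]; split; last by rewrite det_mulmx Y2 Z2 mulr1.
by rewrite trmx_mul mulmxA -(mulmxA Y) Z1 mulmx1.
Qed.

Lemma mul_Omega (a b : 'I_n) p (Y : 'M[R]_(n, p)) x y :
  (Omega R a b *m Y) x y = (x == a)%:R * Y b y - (x == b)%:R * Y a y.
Proof.
rewrite mulmxBl !mxE; congr (_ - _).
- rewrite (bigD1 b)//= big1 => [|z zb]; last first.
    by rewrite mxE (negbTE zb) ?andbF mul0r.
  by rewrite mxE eqxx andbT addr0.
- rewrite (bigD1 a)//= big1 => [|z zb]; last first.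
    by rewrite mxE (negbTE zb) ?andbF mul0r.
  by rewrite mxE eqxx andbT addr0.
Qed.

Lemma OmegaC (a b : 'I_n) : Omega R b a = - Omega R a b.
Proof. by rewrite /Omega opprB. Qed.

Lemma tr_Omega (a b : 'I_n) : (Omega R a b)^T = - Omega R a b.
Proof. by rewrite /Omega linearB /= !trmx_delta opprB. Qed.

Lemma Omega_cube (a b : 'I_n) :
  Omega R a b *m Omega R a b *m Omega R a b = - Omega R a b.
Proof.
rewrite -mulmxA; apply/matrixP => x y; rewrite [RHS]mxE !mul_Omega !mxE !eqxx.
have [<-|ab] := eqVneq a b; first by rewrite /=; ring.
have [->|xa] := eqVneq x a; first by rewrite (negbTE ab) /=; ring.
by have [xb|xb] := eqVneq x b; rewrite /=; ring.
Qed.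

Lemma mul_rotm_Omega (a b : 'I_n) t p (Y : 'M[R]_(n, p)) x y : a != b ->
  (rotm (Omega R a b) t *m Y) x y =
  if x == a then cos t * Y a y + sin t * Y b y
  else if x == b then cos t * Y b y - sin t * Y a y
  else Y x y.
Proof.
move=> ab; have ba : (b == a) = false by rewrite eq_sym (negbTE ab).
rewrite mul_rotm !(mul_Omega, mxE) (negbTE ab) ba !eqxx.
have [->|xa] := eqVneq x a; first by rewrite (negbTE ab) /=; ring.
by have [->|xb] := eqVneq x b; rewrite /=; ring.
Qed.

(** The quarter turn C in the plane (c, b) fixes e_a and sends e_b to e_c, hence
    C Omega_ab = Omega_ac C, and the same relation passes to the exponentials. *)
Lemma rotm_Omega_conj (a b c : 'I_n) t : a != b -> b != c -> a != c ->
  rotm (Omega R a c) t *m rotm (Omega R c b) (pi / 2) =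
  rotm (Omega R c b) (pi / 2) *m rotm (Omega R a b) t.
Proof.
move=> ab bc ac.
have ba : (b == a) = false by rewrite eq_sym (negbTE ab).
have cb : (c == b) = false by rewrite eq_sym (negbTE bc).
have ca : (c == a) = false by rewrite eq_sym (negbTE ac).
set C := rotm _ (pi / 2).
have CW : Omega R a c *m C = C *m Omega R a b.
  apply/matrixP => x y; rewrite -[X in Omega R a c *m X]mulmx1.
  rewrite -[in RHS](mulmx1 (Omega R a b)).
  rewrite /C !mul_Omega !mul_rotm_Omega ?cb// !mul_Omega sin_pihalf cos_pihalf.
  rewrite !eqxx ?(negbTE ab) ?(negbTE bc) ?(negbTE ac) ?ba ?cb ?ca.
  have [->|xc] := eqVneq x c; first by rewrite ?ca /=; ring.
  have [->|xb] := eqVneq x b; first by rewrite ?ba /=; ring.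
  by rewrite /=; ring.
move: C (Omega R a c) (Omega R a b) CW => C V W CW.
rewrite mul_rotm /rotm !mulmxDr mulmx1 -!scalemxAr.
by rewrite CW (mulmxA V) CW -mulmxA.
Qed.

End Rotations.

(** * Givens elimination *)

Lemma exists_angle (R : realType) (x y : R) :
  exists t, cos t * y - sin t * x = 0.
Proof.
have [->|x0] := eqVneq x 0.
  by exists (pi / 2); rewrite cos_pihalf mul0r mulr0 subrr.
exists (atan (y / x)).
have ct : cos (atan (y / x)) != 0.
  by rewrite cos_atan invr_eq0 sqrtr_eq0 -ltNge ltr_wpDr ?sqr_ge0.
have := atanK (y / x); rewrite /tan => /(canRL (divfK ct)) ->.
by field.
Qed.

Section Givens.
Variables (R : realType) (n : nat).
Implicit Types (Y : 'M[R]_n) (k : nat).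

Definition fixes_below k Y :=
  forall x c : 'I_n, (c < k)%N -> Y x c = (x == c)%:R.

Lemma SO_col_dot Y (c d : 'I_n) : SO Y -> \sum_z Y z c * Y z d = (c == d)%:R.
Proof.
move=> [/mulmx1C + _] => /matrixP/(_ c d); rewrite !mxE => <-.
by apply: eq_bigr => z _; rewrite mxE.
Qed.

(** A column e_c forces row c to be e_c as well, by orthogonality of the
    columns. *)
Lemma fixes_row k Y (c x : 'I_n) : SO Y -> fixes_below k Y -> (c < k)%N ->
  Y c x = (c == x)%:R.
Proof.
move=> SY fY ck; rewrite -(SO_col_dot c x SY) (bigD1 c)//=.
rewrite (fY c c ck) eqxx mul1r.
by rewrite big1 ?addr0// => z zc; rewrite (fY z c ck) (negbTE zc) mul0r.
Qed.

Lemma fixes_below_rotm k Y (a b : 'I_n) t :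
  a != b -> (k <= a)%N -> (k <= b)%N ->
  fixes_below k Y -> fixes_below k (rotm (Omega R a b) t *m Y).
Proof.
move=> ab ka kb fY x c ck; rewrite mul_rotm_Omega// !fY//.
have -> : (a == c) = false by apply/eqP => ac; rewrite -ac ltnNge ka in ck.
have -> : (b == c) = false by apply/eqP => bc; rewrite -bc ltnNge kb in ck.
rewrite !mulr0 addr0 subrr.
case: eqVneq => [->|_]; last case: eqVneq => [->|//].
- by case: eqVneq => // ac; rewrite -ac ltnNge ka in ck.
- by case: eqVneq => // bc; rewrite -bc ltnNge kb in ck.
Qed.

(** Y is then diagonal with entries 1 except the last, which equals the
    determinant. *)
Lemma SO_fixes_last (k : 'I_n) Y : SO Y -> fixes_below k Y -> k.+1 = n ->
  Y = 1%:M.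
Proof.
move=> SY fY kn.
have bk (x : 'I_n) : x != k -> (x < k)%N.
  move=> xk; have := ltn_ord x.
  by rewrite -[X in (_ < X)%N]kn ltnS leq_eqVlt (inj_eq val_inj) (negbTE xk).
have YE x y : Y x y = if (x == k) && (y == k) then Y k k else (x == y)%:R.
  case: (eqVneq x k) => [->|xk]; last by rewrite (fixes_row _ SY fY (bk _ xk)).
  case: (eqVneq y k) => [->//|yk] /=.
  by rewrite (fY _ _ (bk _ yk)) eq_sym (negbTE yk).
have detY : \det Y = Y k k.
  rewrite det_trig; last first.
    apply/is_trig_mxP => x y xy; rewrite YE.
    have xny : x != y by rewrite -(inj_eq val_inj) neq_ltn xy.
    case: ifP => [/andP[/eqP xk /eqP yk]|_]; last by rewrite (negbTE xny).
    by rewrite xk yk eqxx in xny.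
  rewrite (bigD1 k)//= big1 ?mulr1// => z zk.
  by rewrite YE (negbTE zk) eqxx.
apply/matrixP => x y; rewrite YE -detY (proj2 SY) mxE.
by case: (eqVneq x k) => [->|_] //=; case: (eqVneq y k).
Qed.

(** An induction principle saying that the rotations of the coordinate planes
    generate SO(n).  The columns are turned into basis vectors from left to
    right; in column k, rotations in the planes (k, r) clear the entries below
    the diagonal from the bottom up, and leave the earlier columns alone because
    those vanish in rows k and r. *)
Lemma SO_Givens_ind (P : 'M[R]_n -> Prop) : P 1%:M ->
  (forall (a b : 'I_n) t Y, a != b -> P (rotm (Omega R a b) t *m Y) -> P Y) ->
  forall Y, SO Y -> P Y.
Proof.
move=> P1 Prot.
suff main d k Y : (k + d = n)%N -> SO Y -> fixes_below k Y -> P Y.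
  by move=> Y SY; apply: (main n 0%N Y).
elim: d k Y => [|d IH] k Y kn SY fY.
  rewrite (_ : Y = 1%:M)//; apply/matrixP => x y; rewrite mxE; apply: fY.
  by rewrite -[k]addn0 kn.
have lt_kn : (k < n)%N by lia.
pose k0 := Ordinal lt_kn.
have SR (a b : 'I_n) t Z : SO Z -> SO (rotm (Omega R a b) t *m Z).
  move=> SZ; apply: SO_mul SZ.
  by apply: rotm_SO; [exact: Omega_cube|exact: tr_Omega].
(* e counts the rows below k in which column k may still be nonzero. *)
suff col e Z : SO Z -> fixes_below k Z ->
    (forall r : 'I_n, (k + e < r)%N -> Z r k0 = 0) -> P Z.
  by apply: (col n Y) => // r kr; have := ltn_ord r; lia.
elim: e Z => [|e IHe] Z SZ fZ zZ; last first.
  have [lt_r|ge_r] := ltnP (k + e.+1) n; last first.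
    by apply: IHe => // r kr; have := ltn_ord r; lia.
  pose r0 := Ordinal lt_r.
  have kr0 : k0 != r0 by rewrite -(inj_eq val_inj) /=; lia.
  have [t ht] := exists_angle (Z k0 k0) (Z r0 k0).
  apply: (Prot k0 r0 t) => //; apply: IHe; first exact: SR.
    by apply: fixes_below_rotm => //=; lia.
  move=> r ker; rewrite mul_rotm_Omega//.
  case: eqVneq => [rk|_]; first by move: ker; rewrite rk /=; lia.
  case: eqVneq => [//|rr0]; apply: zZ.
  by move: rr0; rewrite -(inj_eq val_inj) /=; lia.
have Zk x : x != k0 -> Z x k0 = 0.
  move=> xk; have [kx|xk'] := ltnP k x; first by apply: zZ; rewrite addn0.
  have xk2 : (x < k)%N by move: xk; rewrite -(inj_eq val_inj) /=; lia.
  by rewrite (fixes_row _ SZ fZ) ?(negbTE xk).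
have fixS Z' : fixes_below k Z' -> (forall x, Z' x k0 = (x == k0)%:R) ->
    fixes_below k.+1 Z'.
  move=> fZ' Z'k x c; rewrite ltnS leq_eqVlt => /orP[/eqP ck|]; last exact: fZ'.
  by rewrite (_ : c = k0) ?Z'k//; apply: val_inj.
(* The last column is settled by the determinant. *)
have [kn1|kn1] := eqVneq k.+1 n; first by rewrite (SO_fixes_last (k:=k0) SZ).
have : Z k0 k0 ^+ 2 = 1.
  have := SO_col_dot k0 k0 SZ; rewrite eqxx (bigD1 k0)//= big1 ?addr0//.
  by move=> z zk; rewrite Zk ?mul0r.
move/eqP; rewrite sqrf_eq1 => /orP[] /eqP Zkk.
  apply: (IH k.+1) => //; first by lia.
  by apply: fixS => // x; have [->//|/Zk] := eqVneq x k0.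
(* Column k is -e_k here: a half turn in the plane (k, k + 1) makes it e_k. *)
have lt_k1 : (k.+1 < n)%N by lia.
pose k1 := Ordinal lt_k1.
have k01 : k0 != k1 by rewrite -(inj_eq val_inj) /=; lia.
apply: (Prot k0 k1 pi) => //; apply: (IH k.+1); [by lia|exact: SR|].
apply: fixS; first by apply: fixes_below_rotm => //=; lia.
move=> x; rewrite mul_rotm_Omega// sinpi cospi !mul0r addr0 subr0.
rewrite Zkk mulrNN mulr1.
case: eqVneq => // xk; case: eqVneq => [_|_]; last exact: Zk.
by rewrite Zk ?mulr0// eq_sym.
Qed.

End Givens.

(** * Concatenating trajectories *)

Section MatrixCalculus.
Variables (R : realType) (m n : nat).
Implicit Types X : R -> 'M[R]_(m, n).

Lemma is_derive_mxP X (t : R) (V : 'M[R]_(m, n)) :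
  is_derive t 1 X V <-> forall a b, is_derive t 1 (fun s => X s a b) (V a b).
Proof.
split=> [[dX <-] a b|dX].
  by apply: DeriveDef; [move/derivable_mxP : dX|rewrite derive_mx// mxE].
have dX' : derivable X t 1 by apply/derivable_mxP => a b; case: (dX a b).
apply: DeriveDef => //; rewrite derive_mx//; apply/matrixP => a b.
by rewrite mxE; case: (dX a b).
Qed.

Lemma continuous_mx X :
  (forall a b, continuous (fun s => X s a b)) -> continuous X.
Proof.
move=> cX t; apply/cvg_ballP => e e0.
near=> s; split => // a b.
have : forall ab : 'I_m * 'I_n, ball (X t ab.1 ab.2) e (X s ab.1 ab.2).
  near: s; apply: filter_forall => -[a' b'] /=.
  by have /cvg_ballP/(_ _ e0) := cX a' b' t.
by move/(_ (a, b)).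
Unshelve. all: by end_near. Qed.

End MatrixCalculus.

Lemma continuous_mulmx_entry (R : realType) (m n p : nat) (W : 'M[R]_(m, n))
    (X : R -> 'M[R]_(n, p)) :
  (forall a b, continuous (fun s => X s a b)) ->
  forall a b, continuous (fun s => (W *m X s) a b).
Proof.
move=> cX a b; under [X in continuous X]funext do rewrite mxE.
apply: continuous_big => [|c _]; first exact: add_continuous.
by move=> t; apply: cvgM; [exact: cvg_cst|exact: cX].
Qed.

Section Steering.
Variables (R : realType) (n m : nat) (A : 'I_m -> 'M[R]_n).
Hypothesis A3 : forall k, A k *m A k *m A k = - A k.

(** The witness is a trajectory that stays at its end point Y after time T and
    is continuous on the whole line, so that a further piece can be attached at
    time T as a product, without gluing functions on two intervals. *)
Definition reached (Y : 'M[R]_n) : Prop :=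
  exists T : R, exists u : 'I_m -> R -> R, exists X : R -> 'M[R]_n,
    [/\ 0 <= T, forall k, piecewise_constant T (u k),
        X 0 = 1%:M /\ (forall t, T <= t -> X t = Y),
        forall a b, continuous (fun t => X t a b) &
        exists D : seq R, forall t, t \in `]0, T[ -> t \notin D ->
          is_derive t 1 X ((\sum_(k < m) u k t *: A k) *m X t)].

Lemma reached1 : reached 1%:M.
Proof.
exists 0, (fun _ _ => 0), (fun=> 1%:M); split => //.
- by move=> k; exists [::].
- by move=> a b; exact: cst_continuous.
- by exists [::] => t; rewrite in_itv /= => /andP[/lt_trans h /h]; rewrite ltxx.
Qed.

Lemma piecewise_constant_extend (T c : R) (u : R -> R) : 0 <= T ->
  piecewise_constant T u ->
  piecewise_constant (T + 1) (fun t => if t <= T then u t else c).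
Proof.
move=> T0 [s sT us]; have sT' := sT; case: sT' => ps ls.
exists (rcons s (T + 1)).
  by split; rewrite ?last_rcons ?rcons_path ?ps //= (eqP ls) ltrDl ltr01.
move=> k; rewrite size_rcons ltnS leq_eqVlt => /orP[/eqP ->|ks] x y.
  rewrite -rcons_cons !nth_rcons /= ltnSn ltnn eqxx.
  rewrite (itv_partition_nth_size _ sT) !in_itv /= => /andP[Tx _] /andP[Ty _].
  by rewrite !leNgt Tx Ty.
rewrite -rcons_cons !nth_rcons /= !ltnS ks (ltnW ks).
have le : nth 0 s k <= T.
  have := itv_partition_nth_le (m := k.+1) _ sT; rewrite ltnS => /(_ ks) /=.
  by rewrite (set_nth_default 0).
move=> hx hy; have -> : x <= T.
  by move: hx; rewrite in_itv /= => /andP[_ /ltW/le_trans]; exact.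
have -> : y <= T.
  by move: hy; rewrite in_itv /= => /andP[_ /ltW/le_trans]; exact.
exact: us hx hy.
Qed.

Lemma is_derive_rotm_mul (k : 'I_m) (theta T t : R) (Y : 'M[R]_n) :
  is_derive t 1 (fun s => rotm (A k) (theta * (s - T)) *m Y)
    ((theta *: A k) *m (rotm (A k) (theta * (t - T)) *m Y)).
Proof.
apply/is_derive_mxP => a b; set ang := fun s : R => theta * (s - T).
set p := Y a b; set q := (A k *m Y) a b; set r := (A k *m (A k *m Y)) a b.
have entryE (c d : R) (U V W : 'M[R]_n) :
    (U + c *: V + d *: W) a b = U a b + c * V a b + d * W a b by rewrite !mxE.
have dang : is_derive t 1 ang theta.
  have : is_derive t (1 : R) (theta *: (@id R - cst T)) (theta *: (1 - 0)).
    by apply: is_deriveZ; apply: is_deriveB.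
  by rewrite subr0 /GRing.scale /= mulr1.
have dsin : is_derive t 1 (sin \o ang) (cos (ang t) * theta).
  exact: is_derive1_comp.
have dcos : is_derive t 1 (cos \o ang) (- sin (ang t) * theta).
  exact: is_derive1_comp.
have -> : (fun s => (rotm (A k) (theta * (s - T)) *m Y) a b) =
    cst p + q *: (sin \o ang) + r *: (cst 1 - cos \o ang).
  apply/funext => s; rewrite mul_rotm entryE -/p -/q -/r.
  by rewrite (mulrC (sin _)) (mulrC (1 - _)).
apply: is_derive_eq.
rewrite -scalemxAl mul_rotm !mulmxDr -!scalemxAr !mulmxA A3 mulNmx.
rewrite -!mulmxA.
have -> (c : R) (U V : 'M[R]_n) :
    (theta *: (U + sin c *: V + (1 - cos c) *: - U)) a b =
    theta * (cos c * U a b + sin c * V a b) by rewrite !mxE; ring.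
by rewrite -/q -/r -/(ang t) /GRing.scale /=; ring.
Qed.

(** The new trajectory is rotm (A k) (ang t) *m X t: the angle stays 0 up to
    time T, grows linearly to theta on [T, T + 1], and is constant afterwards. *)
Lemma reached_step (k : 'I_m) (theta : R) (Y : 'M[R]_n) :
  reached Y -> reached (rotm (A k) theta *m Y).
Proof.
move=> [T [u [X [T0 pu [X0 XT] cX [D dX]]]]].
pose ang t := theta * Num.min 1 (Num.max 0 (t - T)).
have ang0 t : t <= T -> ang t = 0.
  by rewrite -subr_le0 /ang => /max_idPl ->; rewrite min_r ?mulr0.
have angE t : T <= t <= T + 1 -> ang t = theta * (t - T).
  move=> /andP[Tt tT]; rewrite /ang max_r ?subr_ge0// min_r//.
  by rewrite lerBlDl.
have ang1 t : T + 1 <= t -> ang t = theta.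
  by rewrite -lerBrDl => h; rewrite /ang max_r ?(le_trans ler01)// min_l ?mulr1.
have cang : continuous ang.
  move=> t; apply: cvgM; first exact: cvg_cst.
  apply: (@continuous_min _ R (cst 1) (fun t => Num.max 0 (t - T))).
    exact: cst_continuous.
  apply: (@continuous_max _ R (cst 0) (fun t => t - T)).
    exact: cst_continuous.
  by apply: cvgB; [exact: cvg_id|exact: cvg_cst].
exists (T + 1), (fun k' t =>
  if t <= T then u k' t else if k' == k then theta else 0).
exists (fun t => rotm (A k) (ang t) *m X t); split.
- by rewrite addr_ge0.
- by move=> k'; exact: piecewise_constant_extend.
- split=> [|t tT]; first by rewrite ang0// rotm0 mul1mx.
  by rewrite ang1// XT// (le_trans _ tT)// lerDl.
- move=> a b.
  under [X in continuous X]funext do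
    rewrite mul_rotm 2!mxE [X in _ + X + _]mxE [X in _ + X]mxE.
  move=> t; apply: cvgD; first (apply: cvgD; first exact: cX); apply: cvgM.
  + by apply: continuous_comp; [exact: cang|exact: continuous_sin].
  + exact: continuous_mulmx_entry.
  + apply: cvgB; first exact: cvg_cst.
    by apply: continuous_comp; [exact: cang|exact: continuous_cos].
  + by do 2 apply: continuous_mulmx_entry.
- exists (T :: D) => t; rewrite in_itv /= inE negb_or.
  move=> /andP[t0 tT1] /andP[tT tD].
  have [ltT|ltT] : t < T \/ T < t by move: tT; rewrite neq_lt => /orP.
  + have t0T : t \in `]0, T[ by rewrite in_itv /= t0.
    rewrite (ang0 t (ltW ltT)) rotm0 mul1mx (ltW ltT).
    apply: near_eq_is_derive (dX _ t0T tD).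
    near=> s; rewrite ang0 ?rotm0 ?mul1mx//.
    have : s \in `]0, T[ by near: s; exact: near_in_itvoo.
    by rewrite in_itv /= => /andP[_ /ltW].
  + have t1T : t \in `]T, (T + 1)[ by rewrite in_itv /= ltT.
    have Tt1 : T <= t <= T + 1 by rewrite !ltW.
    rewrite (angE t Tt1) (XT t (ltW ltT)) leNgt ltT /=.
    have -> : \sum_(k' < m) (if k' == k then theta else 0) *: A k' =
        theta *: A k.
      rewrite (bigD1 k)//= eqxx big1 ?addr0// => z /negbTE ->.
      by rewrite scale0r.
    apply: near_eq_is_derive (is_derive_rotm_mul k theta T t Y).
    near=> s.
    have : s \in `]T, (T + 1)[ by near: s; exact: near_in_itvoo.
    rewrite in_itv /= => /andP[/ltW Ts /ltW sT].
    by rewrite angE ?Ts// XT.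
Unshelve. all: by end_near. Qed.

Lemma reached_trajectory (Y : 'M[R]_n) : reached Y ->
  exists T : R, exists u : 'I_m -> R -> R, exists X : R -> 'M[R]_n,
      [/\ 0 <= T, forall k, piecewise_constant T (u k),
          trajectory A T u X & X T = Y].
Proof.
move=> [T [u [X [T0 pu [X0 XT] cX dX]]]]; exists T, u, X; split => //.
  by split => //; apply: continuous_subspaceT; exact: continuous_mx.
exact: XT.
Qed.

End Steering.

(** * An invariant of disconnected graphs *)

(** The interval is cut at the points of D, and the mean value theorem applies
    to each piece. *)
Lemma is_derive_0_finite_const (R : realType) (D : seq R) (f : R -> R)
    (a b : R) :
  a <= b -> {within `[a, b], continuous f} ->
  (forall t, t \in `]a, b[ -> t \notin D -> is_derive t 1 f 0) -> f a = f b.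
Proof.
elim: D a b => [|d D IH] a b ab cf df.
  apply/esym/eqP; rewrite -subr_eq0.
  have [||c _ ->] := MVT_segment (f := f) (df := fun=> 0) ab => //.
    by move=> t tab; exact: df.
  by rewrite mul0r.
have cfW x y : a <= x -> y <= b -> {within `[x, y], continuous f}.
  move=> ax yb; apply: (continuous_subspaceW _ cf) => t /=.
  rewrite !in_itv /= => /andP[xt ty].
  by rewrite (le_trans ax)// (le_trans ty).
have dfW x y : a <= x -> y <= b -> d \notin `]x, y[ ->
    forall t, t \in `]x, y[ -> t \notin D -> is_derive t 1 f 0.
  move=> ax yb dxy t txy tD; apply: df.
    move: txy; rewrite !in_itv /=.
    by move=> /andP[/(le_lt_trans ax) -> /lt_le_trans ->].
  by rewrite inE negb_or tD andbT; apply: contraNneq dxy => <-.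
have [|dab] := boolP (d \in `]a, b[); last first.
  have [aa bb] := (lexx a, lexx b).
  exact: (IH a b ab (cfW _ _ aa bb) (dfW _ _ aa bb dab)).
rewrite in_itv /= => /andP[/ltW ad /ltW db].
have dad : d \notin `]a, d[ by rewrite in_itv /= ltxx andbF.
have ddb : d \notin `]d, b[ by rewrite in_itv /= ltxx.
transitivity (f d).
  exact: (IH a d ad (cfW _ _ (lexx a) db) (dfW _ _ (lexx a) db dad)).
exact: (IH d b db (cfW _ _ ad (lexx b)) (dfW _ _ ad (lexx b) ddb)).
Qed.

Section Control.
Variables (R : realType) (n m : nat) (i j : 'I_m -> 'I_n).

(** The sum of the squares of the entries of column w in the rows of C is a
    constant of motion: its derivative is twice a sum over C x C of a
    skew-symmetric expression. *)
Lemma trajectory_entry0 (C : pred 'I_n) (T : R) u X (z w : 'I_n) : 0 <= T ->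
  (forall k, C (i k) = C (j k)) ->
  trajectory (fun k => Omega R (i k) (j k)) T u X ->
  C z -> ~~ C w -> X T z w = 0.
Proof.
move=> T0 Cij [X0 cX [D dX]] Cz Cw.
pose f := \sum_(a < n) (C a)%:R *: (fun t => X t a w) ^+ 2.
have fE t : f t = \sum_(a < n) (C a)%:R * X t a w ^+ 2.
  by rewrite /f fct_sumE; apply: eq_bigr => a _.
have f0 : f 0 = 0.
  rewrite fE big1// => a _; rewrite X0 mxE.
  have [->|_] := eqVneq a w; first by rewrite (negbTE Cw) mul0r.
  by rewrite expr0n mulr0.
have cf : {within `[0, T], continuous f}.
  have -> : f =
      (fun M : 'M[R]_n => \sum_(a < n) (C a)%:R * M a w ^+ 2) \o X.
    by apply/funext => t; rewrite fE.
  apply: within_continuous_comp cX => M _; move: M.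
  apply: continuous_big => [|a _ M]; first exact: add_continuous.
  apply: (@continuousM _ _ (cst _) (fun M : 'M[R]_n => M a w ^+ 2)).
    exact: cst_continuous.
  apply: (@continuousM _ _ (fun M : 'M[R]_n => M a w));
    exact: coord_continuous.
suff df t : t \in `]0, T[ -> t \notin D -> is_derive t 1 f 0.
  have := is_derive_0_finite_const T0 cf df; rewrite f0 fE => /esym/eqP.
  rewrite psumr_eq0 => [/allP/(_ z)|a _]; last by rewrite mulr_ge0 ?sqr_ge0.
  by rewrite mem_index_enum Cz mul1r sqrf_eq0 => /(_ isT)/eqP.
move=> tT tD.
pose B := \sum_(k < m) u k t *: Omega R (i k) (j k).
have BN a c : B a c = - B c a.
  rewrite /B !summxE -sumrN; apply: eq_bigr => k _.
  rewrite mxE [in RHS]mxE -mulrN; congr (_ * _).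
  by rewrite !mxE opprB andbC (andbC (a == j k)).
have BC a c : C a != C c -> B a c = 0.
  move=> Cac; rewrite summxE big1// => k _; rewrite !mxE.
  have nac x y : C x = C y -> (a == x) && (c == y) = false.
    by move=> Cxy; apply: contraNF Cac => /andP[/eqP -> /eqP ->]; apply/eqP.
  by rewrite !nac ?subrr ?mulr0.
pose g a c := (C a)%:R * X t a w * B a c * X t c w.
have gN a c : g a c = - g c a.
  rewrite /g; have [->|/BC B0] := eqVneq (C a) (C c).
    by rewrite (BN a c); ring.
  by rewrite (BN c a) B0; ring.
have g0 : \sum_a \sum_c g a c = 0.
  suff : \sum_a \sum_c g a c = - \sum_a \sum_c g a c by lra.
  rewrite [LHS]exchange_big -sumrN; apply: eq_bigr => a _.
  by rewrite -sumrN; apply: eq_bigr => c _.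
have dXt a := (is_derive_mxP X t _).1 (dX t tT tD) a w.
have dfa a := is_deriveZ (C a)%:R (is_deriveX 2 (dXt a)).
have := is_derive_sum dfa; rewrite -/f.
suff -> : \sum_(a < n)
      (C a)%:R *: ((2%:R * X t a w ^+ 2.-1) *: ((B *m X t) a w)) =
    2 * \sum_a \sum_c g a c by rewrite g0 mulr0.
rewrite mulr_sumr; apply: eq_bigr => a _.
rewrite mulr_sumr mxE /GRing.scale /= !mulr_sumr; apply: eq_bigr => c _.
by rewrite /g; ring.
Qed.

(** * Connected graphs and controllability *)

Definition edge_list : seq ('I_n * 'I_n) := [seq (i k, j k) | k <- enum 'I_m].

Lemma edgesP x y :
  reflect (exists k, (x, y) = (i k, j k) \/ (y, x) = (i k, j k))
          (edges edge_list x y).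
Proof.
apply: (iffP orP) => [[]/mapP[k _ e]|[k e]].
- by exists k; left.
- by exists k; right.
- by case: e => e; [left|right]; rewrite e; apply: map_f; rewrite mem_enum.
Qed.

Lemma controllable_connected :
  controllable (fun k => Omega R (i k) (j k)) ->
  forall z w, connect (edges edge_list) z w.
Proof.
move=> ctrl z w; apply: contraT => nzw.
have zw : z != w by apply: contraNneq nzw => ->; exact: connect0.
have SOr : SO (rotm (Omega R z w) (pi / 2)).
  by apply: rotm_SO; [exact: Omega_cube|exact: tr_Omega].
have [T [u [X [T0 _ trX XT]]]] := ctrl _ SOr.
have Cij k :
    connect (edges edge_list) z (i k) = connect (edges edge_list) z (j k).
  have e x y : x = i k /\ y = j k \/ x = j k /\ y = i k ->
      connect (edges edge_list) z x -> connect (edges edge_list) z y.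
    move=> xy /connect_trans; apply; apply: connect1; apply/edgesP; exists k.
    by case: xy => -[-> ->]; [left|right].
  by apply/idP/idP; apply: e; [left|right].
have := trajectory_entry0 T0 Cij trX (connect0 _ z) nzw.
rewrite XT -[rotm _ _]mulmx1 mul_rotm_Omega// eqxx cos_pihalf sin_pihalf.
rewrite !mxE eqxx.
by move/eqP; rewrite mul0r add0r mul1r oner_eq0.
Qed.

(** A closure property under left multiplication, so that such rotations can be
    composed without composing trajectories. *)
Definition steerable_plane (a b : 'I_n) : Prop := forall t Y,
  reached (fun k => Omega R (i k) (j k)) Y ->
  reached (fun k => Omega R (i k) (j k)) (rotm (Omega R a b) t *m Y).

Lemma steerable_plane_sym a b : steerable_plane a b -> steerable_plane b a.
Proof. by move=> gab t Y; rewrite OmegaC rotmN; exact: gab. Qed.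

Lemma steerable_plane_refl a : steerable_plane a a.
Proof.
by move=> t Y; rewrite mul_rotm /Omega subrr !mul0mx !scaler0 !addr0.
Qed.

Lemma steerable_plane_trans a b c :
  steerable_plane a b -> steerable_plane b c -> steerable_plane a c.
Proof.
have [<-//|ab] := eqVneq a b; have [<-//|bc] := eqVneq b c.
have [<- _ _|ac gab gbc t Y rY] := eqVneq a c; first exact: steerable_plane_refl.
(* The rotation of the plane (a, c) is C *m rotm (Omega R a b) t *m C^-1, with C
   the quarter turn in the plane (c, b). *)
have gcb := steerable_plane_sym gbc.
rewrite -[Y]mul1mx -(rotm0 (Omega R c b)) -(subrr (pi / 2)).
rewrite -rotmD; last exact: Omega_cube.
rewrite !mulmxA rotm_Omega_conj// -!mulmxA.
by apply/gcb/gab/gcb.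
Qed.

Lemma connected_steerable_plane : (forall z w, connect (edges edge_list) z w) ->
  forall a b, steerable_plane a b.
Proof.
move=> conn a b; have /connectP[p] := conn a b.
elim: p a => [|c p IH] a /=; first by move=> _ ->; exact: steerable_plane_refl.
move=> /andP[/edgesP[k e] cp] bE; apply: steerable_plane_trans (IH _ cp bE).
have gk : steerable_plane (i k) (j k).
  by move=> t Y; apply: reached_step => ?; exact: Omega_cube.
by case: e => -[-> ->]; last apply: steerable_plane_sym.
Qed.

Lemma connected_controllable : (forall z w, connect (edges edge_list) z w) ->
  controllable (fun k => Omega R (i k) (j k)).
Proof.
move=> /connected_steerable_plane steer Y SY; apply: reached_trajectory.
move: Y SY; apply: SO_Givens_ind; first exact: reached1.
move=> a b t Y ab /(steer a b (- t)).
by rewrite mulmxA rotmK ?mul1mx//; exact: Omega_cube.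
Qed.

Lemma porbit_full_cycle (z w : 'I_n) : w \in porbit (full_cycle n) z.
Proof.
have it d (x : 'I_n) : (x + d < n)%N ->
    exists2 y : 'I_n, y = (x + d)%N :> nat & y \in porbit (full_cycle n) x.
  elim: d x => [|d IH] x xd; first by exists x; rewrite ?addn0 ?porbit_id.
  have [|y yE yx] := IH x; first by rewrite (leq_trans _ xd)// addnS.
  exists (full_cycle n y).
    by rewrite permE /= yE modn_small ?addnS// -addnS.
  apply: porbit_trans yx _; exact: (mem_porbit _ 1).
have up (x y : 'I_n) : (x <= y)%N -> y \in porbit (full_cycle n) x.
  move=> xy; have [|y' y'E] := it (y - x)%N x; first by rewrite subnKC.
  by rewrite subnKC// in y'E; rewrite (val_inj y'E).
by have [/up//|/ltnW/up] := leqP z w; rewrite porbit_sym.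
Qed.

Lemma iota_class_full_cycle (hij : forall k : 'I_m, (i k < j k)%N) :
  iota_class [fset Omega R (i k) (j k) | k in 'I_m]%fset
    = orb_class (full_cycle n) <->
  forall z w, connect (edges edge_list) z w.
Proof.
have -> : [fset Omega R (i k) (j k) | k in 'I_m]%fset =
    [fset Omega R p.1 p.2 | p in edge_list]%fset.
  apply/fsetP => M; apply/imfsetP/imfsetP => /=.
    move=> [k _ ->]; exists (i k, j k) => //; apply: map_f; exact: mem_enum.
  by move=> [p /mapP[k _ ->] ->]; exists k.
rewrite iota_classE; last by apply/allP => p /mapP[k _ ->]; exact: hij.
rewrite orb_class_eq; split => [e z w|conn].
  have : porbit (star_tperms edge_list) z \in porbits (full_cycle n).
    by rewrite -e; apply: imset_f.
  rewrite -star_tperms_porbit => /imsetP[x _ ->]; exact: porbit_full_cycle.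
apply: eq_imset => z; apply/setP => w.
by rewrite star_tperms_porbit conn porbit_full_cycle.
Qed.

End Control.

Theorem theorem4 (R : realType) (n m : nat) (i j : 'I_m -> 'I_n)
    (hn : (2 < n)%N) (hij : forall k : 'I_m, (i k < j k)%N) :
  controllable (fun k : 'I_m => Omega R (i k) (j k)) <->
  iota_class [fset Omega R (i k) (j k) | k in 'I_m]%fset
    = orb_class (full_cycle n).
Proof.
rewrite (iota_class_full_cycle R hij).
by split; [exact: controllable_connected|exact: connected_controllable].
Qed.
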